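(* Let $0<\alpha\le 1$ and let $D\subset\mathbb{R}^d$ be a bounded domain with boundary $\partial D$ of class $C^{2,\alpha}$. Let $V=(V_{ij})$ be a symmetric $d\times d$ matrix-valued function with $V_{ij}\in C^{1,\alpha}(\bar D)$ for all $i,j$ and $V$ positive definite in $\bar D$. Suppose the decision function $(b_1,\dots,b_d)$ is a gradient, $b_i=\partial_i b$ for a real-valued function $b$, with $b_i=\partial_i b\in C^{1,\alpha}(\bar D)$ for each $i$. Then there exists a prior $p$ with $\sqrt p\in C^{2,\alpha}(\bar D)$ and $p>0$ in $D$ such that $$R(b)=R(b^p)=2\sum_{i,j}\partial_i\bigl(V_{ij}\,\partial_j\sqrt p\bigr)\big/\sqrt p .$$
   Context: A domain is an open connected subset of $\mathbb{R}^d$, $\bar D$ is the closure of $D$, and $\partial_i=\partial/\partial x_i$. The matrix $V$ is the asymptotic covariance matrix of an estimation problem with parameter $x\in D$. A decision function is a vector-valued function on $D$ with components $(b_1,\dots,b_d)$; its asymptotic risk relative to the uniform prior, written $R(b)$, is the real-valued function on $D$ $$R(b)=\sum_{i,j}\Bigl\{\partial_i(V_{ij}b_j)+\tfrac12 b_ib_jV_{ij}\Bigr\}.$$ (In the claim the letter $b$ denotes both the scalar function and the decision function whose components are $b_i=\partial_i b$.) A prior is given by its density $p$ on $D$; its decision function is $b^p$, with components $b^p_i=\partial_i\log p$. A function $f$ is uniformly Hölder continuous with exponent $\alpha$, $0<\alpha\le 1$, in $\bar D$ if $\sup_{x,y\in\bar D,\,x\neq y}|f(x)-f(y)|/|x-y|^\alpha<\infty$.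 $C^{k,\alpha}(\bar D)$ is the space of functions whose $k$-th order partial derivatives are uniformly Hölder continuous with exponent $\alpha$ in $\bar D$. For an open set $G$, $C^{k,\alpha}(G)$ consists of functions lying in $C^{k,\alpha}(\bar G')$ for each bounded $G'$ properly included in $G$ (written $G'\subset\subset G$). The boundary $\partial D$ is of class $C^{k,\alpha}$ if for each $x_0\in\partial D$ there is a ball $B$ centered at $x_0$ and a one-to-one mapping $\psi$ of $B$ to $A\subset\mathbb{R}^d$ such that $\psi(B\cap D)\subset\{x\in\mathbb{R}^d:x_d>0\}$, $\psi(B\cap\partial D)\subset\{x\in\mathbb{R}^d:x_d=0\}$, $\psi\in C^{k,\alpha}(B)$ and $\psi^{-1}\in C^{k,\alpha}(A)$. *)

(* Defs.v *)
From HB Require Import structures.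
From mathcomp Require Export all_boot all_order all_algebra.
From mathcomp Require Export all_classical all_reals all_analysis.
Export Order.TTheory GRing.Theory Num.Theory.
Export numFieldNormedType.Exports.

Set Implicit Arguments.
Unset Strict Implicit.
Unset Printing Implicit Defensive.

Local Open Scope classical_set_scope.
Local Open Scope ring_scope.

(* The library norm on 'rV[R]_n is the max norm; it induces the same topology
   and the same bounded sets as the Euclidean norm. *)
Definition enorm (R : realType) (n : nat) (x : 'rV[R]_n) : R :=
  Num.sqrt (\sum_i x 0 i ^+ 2).

Definition eball (R : realType) (n : nat) (x : 'rV[R]_n) (r : R) :
    set 'rV[R]_n :=
  [set y | enorm (y - x) < r].

Definition boundary (T : topologicalType) (A : set T) : set T :=
  closure A `\` interior A.

Definition partial (R : realType) (n : nat) (i : 'I_n)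
    (f : 'rV[R]_n -> R) (x : 'rV[R]_n) : R :=
  'D_(delta_mx 0 i) f x.

Definition partial_exists (R : realType) (n : nat) (i : 'I_n)
    (f : 'rV[R]_n -> R) (x : 'rV[R]_n) : Prop :=
  derivable f x (delta_mx 0 i).

Definition uniformly_holder (R : realType) (n : nat) (alpha : R)
    (A : set 'rV[R]_n) (f : 'rV[R]_n -> R) : Prop :=
  exists C : R, forall x y, A x -> A y -> x != y ->
    `|f x - f y| / enorm (x - y) `^ alpha <= C.

(* C^{k,alpha} of the closure of the open set G, for functions regarded on
   closure G (their values outside closure G are irrelevant).  As usual,
   derivatives are taken in G, and on closure G they are understood as the
   continuous extensions of the derivatives in G: this is the role of g. *)
Fixpoint holder_closure (R : realType) (n k : nat) (alpha : R)
    (G : set 'rV[R]_n) (f : 'rV[R]_n -> R) : Prop :=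
  match k with
  | 0%N => uniformly_holder alpha (closure G) f
  | k'.+1 =>
      {within closure G, continuous f} /\
      forall i : 'I_n, exists g : 'rV[R]_n -> R,
        (forall x, G x -> partial_exists i f x /\ partial i f x = g x) /\
        holder_closure k' alpha G g
  end.

(* C^{k,alpha}(G) for open G; G' is relatively compact in G. *)
Definition holder_open (R : realType) (n k : nat) (alpha : R)
    (G : set 'rV[R]_n) (f : 'rV[R]_n -> R) : Prop :=
  forall G' : set 'rV[R]_n, open G' -> bounded_set G' -> closure G' `<=` G ->
    holder_closure k alpha G' f.

Definition holder_map (R : realType) (n k : nat) (alpha : R)
    (G : set 'rV[R]_n) (psi : 'rV[R]_n -> 'rV[R]_n) : Prop :=
  forall i : 'I_n, holder_open k alpha G (fun x => psi x 0 i).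

(* The last coordinate x_d is x 0 ord_max.  The map phi is the inverse of the
   restriction of psi to the ball B, whose existence makes psi one-to-one. *)
Definition holder_boundary (R : realType) (d k : nat) (alpha : R)
    (D : set 'rV[R]_d.+1) : Prop :=
  forall x0, boundary D x0 ->
  exists (r : R) (psi phi : 'rV[R]_d.+1 -> 'rV[R]_d.+1),
    let B := eball x0 r in
    let A := psi @` B in
    [/\ 0 < r,
        (forall x, B x -> phi (psi x) = x) /\ open A,
        psi @` (B `&` D) `<=` [set x | 0 < x 0 ord_max],
        psi @` (B `&` boundary D) `<=` [set x | x 0 ord_max = 0] &
        holder_map k alpha B psi /\ holder_map k alpha A phi].

Definition is_domain (R : realType) (n : nat) (D : set 'rV[R]_n) : Prop :=
  open D /\ connected D.

Definition positive_definite (R : realType) (n : nat) (M : 'M[R]_n) : Prop :=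
  forall u : 'rV[R]_n, u != 0 -> 0 < (u *m M *m u^T) 0 0.

Definition risk (R : realType) (n : nat) (V : 'rV[R]_n -> 'M[R]_n)
    (b : 'I_n -> 'rV[R]_n -> R) (x : 'rV[R]_n) : R :=
  \sum_i \sum_j (partial i (fun y => V y i j * b j y) x
                 + 2^-1 * (b i x * b j x * V x i j)).

(* Only p on D matters.  Prior densities need not have total mass one (the
   reference prior is uniform), and p and c p give the same decision function
   for every c > 0. *)
Definition prior_decision (R : realType) (n : nat) (p : 'rV[R]_n -> R)
    (i : 'I_n) : 'rV[R]_n -> R :=
  partial i (fun y => ln (p y)).

(* Main.v *)
Require Import Defs.
From mathcomp Require Import ring lra.

(* The prior is [p = exp b], so that [sqrt p = exp (b / 2)]; the formula for the
   risk is then the product rule.  The analytic content is the regularity of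
   [sqrt p] up to the boundary, [b] being controlled only inside [D]: a function
   with bounded partial derivatives on [D] is Lipschitz on [D].  Near a boundary
   point the chart maps [D] onto a half cube, which is convex, so one integrates
   along the preimages of segments; compactness of the closure makes the
   estimate global.  Thus [b] extends to a Lipschitz function, and
   [exp (b / 2)] and the [b_i] are Lipschitz, hence Hoelder, on the closure, and
   so are the products giving the second derivatives of [sqrt p]. *)

Set Implicit Arguments.
Unset Strict Implicit.
Unset Printing Implicit Defensive.

Local Open Scope classical_set_scope.
Local Open Scope ring_scope.

(** * Derivatives along lines, and the maximum norm against the Euclidean norm *)

(** The two difference quotients are the same function of [h], so one-variable calculus applies
    along lines. *)
Lemma is_derive_lineP (R : realType) (n : nat) (f : 'rV[R]_n -> R)
    (x v : 'rV[R]_n) (t l : R) :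
  is_derive t 1 (fun h => f (x + h *: v)) l <-> is_derive (x + t *: v) v f l.
Proof.
have E : (fun h : R => h^-1 *: (((fun h => f (x + h *: v)) \o shift t) (h *: 1)
            - f (x + t *: v))) =
         (fun h => h^-1 *: ((f \o shift (x + t *: v)) (h *: v)
            - f (x + t *: v))).
  apply/funext => h /=; congr (_ *: (f _ - _)).
  by rewrite [h%:A]mulr1 scalerDl addrA addrAC addrA addrAC [x + _]addrC.
have Ed : derivable (fun h : R => f (x + h *: v)) t 1 = derivable f (x + t *: v) v.
  by rewrite /derivable E.
have ED : 'D_1 (fun h : R => f (x + h *: v)) t = 'D_v f (x + t *: v).
  by rewrite /derive E.
split=> -[h1 h2]; split.
- by rewrite -Ed.
- by rewrite -ED.
- by rewrite Ed.
- by rewrite ED.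
Qed.

Lemma normr_coord_le (R : realType) (n : nat) (x : 'rV[R]_n) i :
  `|x 0 i| <= `|x|.
Proof.
rewrite [leRHS]/Num.norm /= mx_normrE.
exact: (le_bigmax _ (fun ij => `|x ij.1 ij.2|) (0, i)).
Qed.

Lemma normr_rV_le (R : realType) (n : nat) (x : 'rV[R]_n) (e : R) : 0 <= e ->
  (forall i, `|x 0 i| <= e) -> `|x| <= e.
Proof.
move=> e0 xe; rewrite /Num.norm /= mx_normrE; apply: bigmax_le => // -[i j] _ /=.
by rewrite ord1.
Qed.

Lemma normr_rV_lt (R : realType) (n : nat) (x : 'rV[R]_n) (e : R) : 0 < e ->
  (forall i, `|x 0 i| < e) -> `|x| < e.
Proof.
move=> e0 xe; rewrite /Num.norm /= mx_normrE; apply: bigmax_lt => // -[i j] _ /=.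
by rewrite ord1.
Qed.

Lemma normr_le_enorm (R : realType) (n : nat) (x : 'rV[R]_n) : `|x| <= enorm x.
Proof.
apply: normr_rV_le => [|i]; first exact: sqrtr_ge0.
rewrite -sqrtr_sqr ler_wsqrtr// (bigD1 i)//= lerDl.
by apply: sumr_ge0 => j _; exact: sqr_ge0.
Qed.

Lemma enorm_le_normr (R : realType) (n : nat) (x : 'rV[R]_n) :
  enorm x <= n%:R * `|x|.
Proof.
rewrite -[leRHS]ger0_norm ?mulr_ge0// -sqrtr_sqr ler_wsqrtr//.
apply: (@le_trans _ _ (\sum_(i < n) `|x| ^+ 2)).
  by apply: ler_sum => i _; rewrite -real_normK ?num_real// lerXn2r ?nnegrE//
    normr_coord_le.
rewrite sumr_const card_ord -[leLHS]mulr_natl exprMn ler_wpM2r ?sqr_ge0//.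
by rewrite -natrX ler_nat; case: n {x} => // n; rewrite leq_pmulr.
Qed.

Lemma enorm_gt0 (R : realType) (n : nat) (x : 'rV[R]_n) : x != 0 -> 0 < enorm x.
Proof. by move=> x0; apply: lt_le_trans (normr_le_enorm x); rewrite normr_gt0. Qed.

(** * Lipschitz estimates on cubes and segments *)

Lemma lip_coord (R : realType) (f df : R -> R) (a b M : R) :
  (forall t, t \in `[Num.min a b, Num.max a b] -> is_derive t 1 f (df t)) ->
  (forall t, t \in `[Num.min a b, Num.max a b] -> `|df t| <= M) ->
  `|f b - f a| <= M * `|b - a|.
Proof.
wlog ab : a b / a <= b => [H|].
  have /orP[/H//|/H ba] := le_total a b.
  by rewrite minC maxC distrC [`|b - a|]distrC.
rewrite min_l// max_r// => fdf dfM.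
have fdf_oo t : t \in `]a, b[ -> is_derive t 1 f (df t).
  by move=> tab; apply: fdf; exact: subset_itv_oo_cc.
have fc : {within `[a, b], continuous f}.
  by apply: derivable_within_continuous => t tab; have [] := fdf t tab.
have [c ci E] := MVT_segment ab fdf_oo fc.
by rewrite E normrM ler_wpM2r// dfM.
Qed.

(** Balls of the maximum norm are cubes, so one can pass from [y] to [x] by changing one coordinate
    at a time without leaving the ball. Each change is a mean value estimate, so partial derivatives
    suffice. *)
Lemma lip_cube (R : realType) (n : nat) (f : 'rV[R]_n -> R) (a : 'rV[R]_n)
    (r M : R) :
  (forall i x, ball a r x -> partial_exists i f x) ->
  (forall i x, ball a r x -> `|partial i f x| <= M) ->
  forall x y, ball a r x -> ball a r y -> `|f x - f y| <= n%:R * M * `|x - y|.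
Proof.
move=> df dfM x y ax ay.
have r0 : 0 < r by move: ax; rewrite -ball_normE /=; exact: le_lt_trans.
pose z (k : nat) : 'rV[R]_n := \row_j (if (j < k)%N then x 0 j else y 0 j).
have coord w : ball a r w -> forall j, `|a 0 j - w 0 j| < r.
  rewrite -ball_normE /= => aw j; apply: le_lt_trans aw.
  by have := normr_coord_le (a - w) j; rewrite !mxE.
have zn : z n = x by apply/rowP => j; rewrite mxE ltn_ord.
have zz : z 0%N = y by apply/rowP => j; rewrite mxE.
have -> : f x - f y = \sum_(k < n) (f (z k.+1) - f (z k)).
  rewrite -(big_mkord xpredT (fun k => f (z k.+1) - f (z k))).
  by rewrite (telescope_sumr (f \o z))//= zn zz.
apply: le_trans (ler_norm_sum _ _ _) _.
have -> : n%:R * M * `|x - y| = \sum_(k < n) (M * `|x - y|).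
  by rewrite sumr_const card_ord -[RHS]mulr_natl mulrA.
apply: ler_sum => k _.
have M0 : 0 <= M by have := dfM k x ax; apply: le_trans; rewrite normr_ge0.
have zS : z k.+1 = z k + (x 0 k - y 0 k) *: delta_mx 0 k.
  apply/rowP => j; rewrite !mxE eqxx /= ltnS leq_eqVlt -val_eqE /=.
  case: ltngtP => jk //=; rewrite ?mulr0 ?addr0//.
  by rewrite (val_inj jk : j = k) mulr1 addrC subrK.
have z0 : z k = z k + 0 *: delta_mx 0 k by rewrite scale0r addr0.
rewrite zS [in X in _ - f X]z0.
(* The moving coordinate stays between those of [y] and [x], whatever their order. *)
have zi t : t \in `[Num.min 0 (x 0 k - y 0 k), Num.max 0 (x 0 k - y 0 k)] ->
    ball a r (z k + t *: delta_mx 0 k).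
  move=> ti; rewrite -ball_normE /=; apply: normr_rV_lt => // j.
  rewrite !mxE eqxx /=; case: eqP => [->|_] /=; last first.
    by rewrite mulr0 addr0; case: ifP => _; exact: coord.
  rewrite ltnn mulr1.
  have := coord _ ax k; have := coord _ ay k; move: ti; rewrite in_itv /=.
  rewrite !ltr_norml; case: (leP 0 (x 0 k - y 0 k)) => xy; lra.
apply: le_trans (_ : M * `|x 0 k - y 0 k| <= _); last first.
  by rewrite ler_wpM2l//; have := normr_coord_le (x - y) k; rewrite !mxE.
rewrite -[X in M * `|X|]subr0.
apply: (@lip_coord _ (fun t => f (z k + t *: delta_mx 0 k))
  (fun t => partial k f (z k + t *: delta_mx 0 k))) => t ti.
- by apply/is_derive_lineP; apply: derivableP; exact: df (zi t ti).
- by apply: dfM; exact: zi.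
Qed.

(** Continuous induction: the local estimate to the left of [sup S] puts it in [S], and the local
    estimate to its right excludes [sup S < 1]. *)
Lemma lip_segment (R : realType) (f : R -> R) (K : R) : 0 <= K ->
  (forall t : R, 0 <= t <= 1 ->
     \forall s \near t, 0 <= s <= 1 -> `|f s - f t| <= K * `|s - t|) ->
  `|f 1 - f 0| <= K.
Proof.
move=> K0 lf; pose S := [set t | 0 <= t <= 1 /\ `|f t - f 0| <= K * t].
have S0 : S 0 by split; rewrite ?lexx ?ler01// subrr normr0 mulr0.
have ubS : ubound S 1 by move=> t [/andP[]].
have supS : has_sup S by split; [exists 0|exists 1].
have s01 : 0 <= sup S <= 1.
  by rewrite ub_le_sup ?ge_sup//; [exists 0|exists 1].
have /nbhs_ballP[e /= e0 he] := lf _ s01.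
have Ss : `|f (sup S) - f 0| <= K * sup S.
  have [t St te] := sup_adherent e0 supS.
  have ts : t <= sup S by apply: ub_le_sup => //; exists 1.
  have := he t; rewrite -ball_normE /= ger0_norm ?subr_ge0// => /(_ _ St.1).
  rewrite distrC [`|t - _|]distrC (@ger0_norm _ (_ - t)) ?subr_ge0// => h.
  have {}h : `|f (sup S) - f t| <= K * (sup S - t) by apply: h; lra.
  rewrite -(subrK (f t) (f (sup S))) -addrA; apply: le_trans (ler_normD _ _) _.
  by have := St.2; lra.
have [s1|s1] := ltP (sup S) 1; last first.
  have /andP[_ s1'] := s01; have -> : 1 = sup S by apply/le_anti/andP.
  by apply: le_trans Ss _; rewrite ler_piMr.
(* A point of the unit interval beyond [sup S] yet closer than [e] to it; it will lie in [S], a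
   contradiction. *)
pose u := Num.min 1 (sup S + e / 2).
have su : sup S < u by rewrite lt_min s1 ltrDl divr_gt0.
have u1 : u <= 1 by rewrite ge_min lexx.
have ue : u <= sup S + e / 2 by rewrite ge_min lexx orbT.
have u01 : 0 <= u <= 1 by rewrite u1 andbT; case/andP: s01; lra.
suff : u <= sup S by lra.
apply: ub_le_sup; first by exists 1.
split=> //; have := he u.
rewrite -ball_normE /= distrC gtr0_norm ?subr_gt0// => /(_ _ u01) h.
have {}h : `|f u - f (sup S)| <= K * (u - sup S) by apply: h; lra.
rewrite -(subrK (f (sup S)) (f u)) -addrA; apply: le_trans (ler_normD _ _) _.
lra.
Qed.

(** * Closures, compactness and continuity up to the boundary *)

Lemma closure_near (R : realType) (V : normedModType R) (A : set V) (x : V)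
    (e : R) : 0 < e -> closure A x -> exists2 y, A y & `|x - y| < e.
Proof.
move=> e0 /(_ _ (nbhsx_ballx x e e0))[y [Ay]]; rewrite -ball_normE /= => xy.
by exists y.
Qed.

Lemma bounded_set_le (R : realType) (V : normedModType R) (A : set V) :
  bounded_set A -> exists2 M : R, 0 <= M & forall x, A x -> `|x| <= M.
Proof.
move=> [M [_ AM]]; exists (`|M| + 1) => [|x Ax]; first by rewrite addr_ge0.
apply: (AM (`|M| + 1)) => //.
by apply: le_lt_trans (ler_norm M) _; rewrite ltrDl.
Qed.

Lemma le_bounded_set (R : realType) (V : normedModType R) (A : set V) (M : R) :
  (forall x, A x -> `|x| <= M) -> bounded_set A.
Proof.
by move=> AM; exists M; split=> [|N /ltW MN x Ax]; [exact: num_real|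
  exact: le_trans (AM x Ax) MN].
Qed.

Lemma bounded_set_closure (R : realType) (V : normedModType R) (A : set V) :
  bounded_set A -> bounded_set (closure A).
Proof.
move=> /bounded_set_le[M M0 AM]; apply: (@le_bounded_set _ _ _ (M + 1)) => x.
move=> /(closure_near ltr01)[y Ay /ltW xy].
rewrite -(subrK y x) addrC; apply: le_trans (ler_normD _ _) _.
exact: lerD (AM _ Ay) xy.
Qed.

Lemma compact_closure_bounded (R : realType) (n : nat) (A : set 'rV[R]_n) :
  bounded_set A -> compact (closure A).
Proof.
by move=> /bounded_set_closure bA; exact: bounded_closed_compact bA
  (@closed_closure _ A).
Qed.

Lemma within_continuous_bounded (R : realType) (n : nat) (A : set 'rV[R]_n)
    (f : 'rV[R]_n -> R) :
  bounded_set A -> {within closure A, continuous f} ->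
  exists2 M, 0 <= M & forall x, closure A x -> `|f x| <= M.
Proof.
move=> /compact_closure_bounded cA fc.
have /compact_bounded/bounded_set_le[M M0 fM] := continuous_compact fc cA.
by exists M => // x Ax; apply: fM; exists x.
Qed.

Lemma within_lip_continuous (R : realType) (U V : normedModType R) (A : set U)
    (f : U -> V) (C : R) :
  (forall x y, A x -> A y -> `|f x - f y| <= C * `|x - y|) ->
  {within A, continuous f}.
Proof.
move=> fC; apply/subspace_continuousP => x Ax; apply/cvgrPdist_lt => e e0.
have C1 : 0 < `|C| + 1 by rewrite ltr_wpDl.
rewrite near_withinE; near=> y => Ay.
apply: le_lt_trans (fC _ _ Ax Ay) _.
apply: (@le_lt_trans _ _ ((`|C| + 1) * `|x - y|)).
  by rewrite ler_wpM2r// ler_wpDr// ler_norm.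
rewrite mulrC -ltr_pdivlMr//; near: y.
by apply: cvgr_dist_lt; [exact: cvg_id|rewrite divr_gt0].
Unshelve. all: by end_near. Qed.

(** Limit argument: both points are approximated from [A], in position and in value. *)
Lemma lip_closure (R : realType) (U V : normedModType R) (A : set U)
    (f : U -> V) (C : R) : 0 <= C ->
  {within closure A, continuous f} ->
  (forall x y, A x -> A y -> `|f x - f y| <= C * `|x - y|) ->
  forall x y, closure A x -> closure A y -> `|f x - f y| <= C * `|x - y|.
Proof.
move=> C0 /subspace_continuousP fc fC x y Ax Ay.
have near_pt z e : 0 < e -> closure A z ->
    exists z', [/\ A z', `|z - z'| < e & `|f z - f z'| < e].
  move=> e0 Az; have /cvgrPdist_lt/(_ _ e0) := fc z Az.
  rewrite near_withinE => /nbhs_ballP[r /= r0 zr].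
  have re : 0 < Num.min r e by rewrite lt_min r0.
  have [z' Az' zz'] := closure_near re Az.
  exists z'; split=> //; first by apply: lt_le_trans zz' _; rewrite ge_min lexx orbT.
  apply: zr; last exact: subset_closure.
  by rewrite -ball_normE /=; apply: lt_le_trans zz' _; rewrite ge_min lexx.
apply/ler_addgt0Pr => e e0.
have d0 : 0 < 2 * (C + 1) by lra.
(* The error is [d] for each value and [C * d] for each point, in all [2 * (C + 1) * d = e]. *)
pose d := e / (2 * (C + 1)).
have de : e = 2 * (C + 1) * d by rewrite /d mulrC divfK// gt_eqF.
have {}d0 : 0 < d by rewrite divr_gt0.
have [x' [Ax' xx' fx]] := near_pt x d d0 Ax.
have [y' [Ay' yy' fy]] := near_pt y d d0 Ay.
have -> : f x - f y = (f x - f x') + (f x' - f y') - (f y - f y').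
  by rewrite opprB !subrKA.
apply: le_trans (ler_normB _ _) _.
have := ler_normD (f x - f x') (f x' - f y').
have := fC _ _ Ax' Ay'.
have : C * `|x' - y'| <= C * (`|x - y| + 2 * d).
  apply: ler_wpM2l => //.
  have -> : x' - y' = (x - y) - (x - x') + (y - y').
    by rewrite opprB [x - y + _]addrC !subrKA.
  have := ler_normD ((x - y) - (x - x')) (y - y').
  have := ler_normB (x - y) (x - x'); lra.
rewrite de mulrDr; lra.
Qed.

(** * Bounded Hölder functions *)

(** Keeping a sup bound next to the Hölder bound makes the class stable under products; the
    multiplied-out inequality also covers [x = y]. *)
Definition bounded_holder (R : realType) (n : nat) (alpha : R)
    (A : set 'rV[R]_n) (f : 'rV[R]_n -> R) : Prop :=
  exists2 C, 0 <= C & (forall x, A x -> `|f x| <= C) /\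
    forall x y, A x -> A y -> `|f x - f y| <= C * enorm (x - y) `^ alpha.

Lemma bounded_holder_uniformly (R : realType) (n : nat) (alpha : R)
    (A : set 'rV[R]_n) (f : 'rV[R]_n -> R) :
  bounded_holder alpha A f -> uniformly_holder alpha A f.
Proof.
move=> [C C0 [_ fC]]; exists C => x y Ax Ay xy.
by rewrite ler_pdivrMr; [exact: fC|rewrite powR_gt0// enorm_gt0// subr_eq0].
Qed.

Lemma uniformly_holder_bounded (R : realType) (n : nat) (alpha : R)
    (A : set 'rV[R]_n) (f : 'rV[R]_n -> R) : 0 < alpha ->
  bounded_set A -> uniformly_holder alpha A f -> bounded_holder alpha A f.
Proof.
move=> a0 /bounded_set_le[M M0 AM] [C fC].
have {}fC x y : A x -> A y -> `|f x - f y| <= `|C| * enorm (x - y) `^ alpha.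
  move=> Ax Ay; have [->|xy] := eqVneq x y.
    by rewrite subrr normr0 mulr_ge0// powR_ge0.
  rewrite -ler_pdivrMr ?powR_gt0 ?enorm_gt0 ?subr_eq0//.
  exact: le_trans (fC _ _ Ax Ay xy) (ler_norm C).
have [[x0 Ax0]|A0] := pselect (A !=set0); last first.
  by exists 0 => //; split=> [x Ax|x y Ax]; exfalso; apply: A0; exists x.
(* Bounds the power of the distance of two points of [A], the Euclidean norm being at most [n] times
   the maximum norm. *)
pose L := (n%:R * (M + M)) `^ alpha.
have L0 : 0 <= L := powR_ge0 _ _.
exists (`|f x0| + `|C| * L + `|C|); first by rewrite !addr_ge0// mulr_ge0.
split=> [x Ax|x y Ax Ay]; last first.
  apply: le_trans (fC _ _ Ax Ay) _; rewrite ler_wpM2r ?powR_ge0// lerDr.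
  by rewrite addr_ge0// mulr_ge0.
rewrite -(subrK (f x0) (f x)) addrC; apply: le_trans (ler_normD _ _) _.
rewrite -!addrA lerD2l ler_wpDr//; apply: le_trans (fC _ _ Ax Ax0) _.
rewrite ler_wpM2l// ge0_ler_powR ?(ltW a0) ?nnegrE ?sqrtr_ge0 ?mulr_ge0 ?addr_ge0//.
apply: le_trans (enorm_le_normr _) _; rewrite ler_wpM2l//.
by apply: le_trans (ler_normB _ _) _; rewrite lerD ?AM.
Qed.

(** Up to distance 1 a distance is at most its power with exponent [alpha <= 1]; beyond distance 1
    the power is at least 1 and the bound [M + M] on the oscillation is enough. *)
Lemma bounded_lip_holder (R : realType) (n : nat) (alpha M C : R)
    (A : set 'rV[R]_n) (f : 'rV[R]_n -> R) : 0 < alpha -> alpha <= 1 ->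
  0 <= M -> 0 <= C ->
  (forall x, A x -> `|f x| <= M) ->
  (forall x y, A x -> A y -> `|f x - f y| <= C * `|x - y|) ->
  bounded_holder alpha A f.
Proof.
move=> a0 a1 M0 C0 fM fC; exists (M + M + C); first by rewrite !addr_ge0.
split=> [x Ax|x y Ax Ay].
  by apply: le_trans (fM x Ax) _; rewrite -addrA lerDl addr_ge0.
have e0 : 0 <= enorm (x - y) := sqrtr_ge0 _.
have [e1|e1] := leP (enorm (x - y)) 1.
  apply: le_trans (fC x y Ax Ay) _; apply: ler_pM => //.
    by rewrite lerDr addr_ge0.
  apply: le_trans (normr_le_enorm _) _; move: e0; rewrite le_eqVlt.
  move=> /predU1P[<-|e0]; first exact: powR_ge0.
  by rewrite -[leLHS](powRr1 (ltW e0)) ger_powR// e0.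
apply: (@le_trans _ _ (M + M)).
  by apply: le_trans (ler_normB _ _) _; rewrite lerD ?fM.
apply: (@le_trans _ _ (M + M + C)); first by rewrite lerDl.
rewrite ler_peMr ?addr_ge0//.
rewrite -[leLHS](congr1 (fun g => g alpha) (powR1 R)).
by rewrite ge0_ler_powR ?nnegrE ?(ltW a0) ?(ltW e1).
Qed.

Lemma bounded_holderM (R : realType) (n : nat) (alpha : R)
    (A : set 'rV[R]_n) (f g : 'rV[R]_n -> R) :
  bounded_holder alpha A f -> bounded_holder alpha A g ->
  bounded_holder alpha A (fun x => f x * g x).
Proof.
move=> [C C0 [fC hf]] [E E0 [gE hg]]; exists (2 * C * E).
  by rewrite !mulr_ge0.
split=> [x Ax|x y Ax Ay].
  rewrite normrM; apply: (@le_trans _ _ (C * E)); first by rewrite ler_pM ?fC ?gE.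
  by rewrite -mulrA ler_peMl ?mulr_ge0// ler1n.
have -> : f x * g x - f y * g y = f x * (g x - g y) + (f x - f y) * g y by ring.
apply: le_trans (ler_normD _ _) _; rewrite !normrM.
have -> : 2 * C * E * enorm (x - y) `^ alpha =
  C * (E * enorm (x - y) `^ alpha) + (C * enorm (x - y) `^ alpha) * E by ring.
by rewrite lerD// ler_pM// ?fC ?gE ?hf ?hg.
Qed.

Lemma bounded_holderD (R : realType) (n : nat) (alpha : R)
    (A : set 'rV[R]_n) (f g : 'rV[R]_n -> R) :
  bounded_holder alpha A f -> bounded_holder alpha A g ->
  bounded_holder alpha A (fun x => f x + g x).
Proof.
move=> [C C0 [fC hf]] [E E0 [gE hg]]; exists (C + E); first by rewrite addr_ge0.
split=> [x Ax|x y Ax Ay].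
  by apply: le_trans (ler_normD _ _) _; rewrite lerD ?fC ?gE.
rewrite opprD addrACA; apply: le_trans (ler_normD _ _) _.
by rewrite mulrDl lerD ?hf ?hg.
Qed.

Lemma bounded_holder_cst (R : realType) (n : nat) (alpha c : R)
    (A : set 'rV[R]_n) : bounded_holder alpha A (fun=> c).
Proof.
exists `|c| => //; split=> // x y _ _.
by rewrite subrr normr0 mulr_ge0// powR_ge0.
Qed.

(** * Bounded partial derivatives and Lipschitz charts *)

Definition bounded_partials (R : realType) (n : nat) (A : set 'rV[R]_n)
    (f : 'rV[R]_n -> R) (M : R) : Prop :=
  forall i x, A x -> partial_exists i f x /\ `|partial i f x| <= M.

(** Only boundedness of the extended derivatives matters, so their class [P] is left open: it will
    be a Hölder class or plain continuity. *)
Lemma bounded_partials_of (R : realType) (n : nat) (A : set 'rV[R]_n)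
    (f : 'rV[R]_n -> R) (P : ('rV[R]_n -> R) -> Prop) :
  (forall g, P g -> exists2 M, 0 <= M & forall x, closure A x -> `|g x| <= M) ->
  (forall i : 'I_n, exists g : 'rV[R]_n -> R,
     (forall x, A x -> partial_exists i f x /\ partial i f x = g x) /\ P g) ->
  exists2 M, 0 <= M & bounded_partials A f M.
Proof.
move=> PM fg.
have H i : exists M, 0 <= M /\
    forall x, A x -> partial_exists i f x /\ `|partial i f x| <= M.
  have [g [fgi /PM[M M0 gM]]] := fg i; exists M; split=> // x Ax.
  have [? ->] := fgi x Ax; split=> //; apply: gM; exact: subset_closure.
have [M HM] := choice H.
exists (\sum_i M i); first by apply: sumr_ge0 => i _; have [] := HM i.
move=> i x Ax; have [_ /(_ x Ax)[? fM]] := HM i; split=> //.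
apply: le_trans fM _; rewrite (bigD1 i)//= lerDl sumr_ge0// => j _.
by have [] := HM j.
Qed.

Lemma holder_closure1_partials (R : realType) (n : nat) (alpha : R)
    (A : set 'rV[R]_n) (f : 'rV[R]_n -> R) : 0 < alpha -> bounded_set A ->
  holder_closure 1 alpha A f -> exists2 M, 0 <= M & bounded_partials A f M.
Proof.
move=> a0 bA [_]; apply: (@bounded_partials_of _ _ _ _ (holder_closure 0 alpha A)) => g.
move=> /(uniformly_holder_bounded a0 (bounded_set_closure bA))[M M0 [gM _]].
by exists M.
Qed.

(** From order two on, the extended derivatives are continuous on the closure, so the bound comes
    from compactness; at order one it comes from the Hölder condition. *)
Lemma holder_closureSS_partials (R : realType) (n k : nat) (alpha : R)
    (A : set 'rV[R]_n) (f : 'rV[R]_n -> R) : bounded_set A ->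
  holder_closure k.+2 alpha A f -> exists2 M, 0 <= M & bounded_partials A f M.
Proof.
move=> bA [_]; apply: (@bounded_partials_of _ _ _ _ (holder_closure k.+1 alpha A)) => g.
by case=> gc _; exact: within_continuous_bounded bA gc.
Qed.

(** [holder_map] controls only sets whose closure lies in [G], hence the hypothesis on the ball.
    There each coordinate is Lipschitz by [lip_cube]. *)
Lemma holder_map_lip (R : realType) (n k : nat) (alpha r : R) (a : 'rV[R]_n)
    (G : set 'rV[R]_n) (psi : 'rV[R]_n -> 'rV[R]_n) :
  closure (ball a r) `<=` G -> holder_map k.+2 alpha G psi ->
  exists2 L, 0 <= L &
    forall x y, ball a r x -> ball a r y -> `|psi x - psi y| <= L * `|x - y|.
Proof.
move=> aG psiG.
have bB : bounded_set (ball a r).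
  apply: (@le_bounded_set _ _ _ (`|a| + r)) => x; rewrite -ball_normE /= => ax.
  rewrite -(subKr a x); apply: le_trans (ler_normB _ _) _.
  by rewrite lerD2l ltW.
have H i : exists M, 0 <= M /\ bounded_partials (ball a r) (fun x => psi x 0 i) M.
  have [M M0 HM] := holder_closureSS_partials bB (psiG i _ (ball_open a r) bB aG).
  by exists M.
have [M HM] := choice H.
have M0 : 0 <= \sum_i M i by apply: sumr_ge0 => i _; have [] := HM i.
exists (n%:R * \sum_i M i); first by rewrite mulr_ge0.
move=> x y ax ay; apply: normr_rV_le => [|i]; first by rewrite !mulr_ge0.
have -> : (psi x - psi y) 0 i = psi x 0 i - psi y 0 i by rewrite !mxE.
apply: (@lip_cube _ _ (fun x => psi x 0 i) a r) => // j z az.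
  by have [_ /(_ j z az)[]] := HM i.
have [_ /(_ j z az)[_ h]] := HM i; apply: le_trans h _.
rewrite (bigD1 i)//= lerDl sumr_ge0// => l _; by have [] := HM l.
Qed.

(** * Flattening the boundary *)

Lemma segment_coord_gt0 (R : realType) (n : nat) (u v : 'rV[R]_n) (i : 'I_n)
    (t : R) :
  0 <= t <= 1 -> 0 < u 0 i -> 0 < v 0 i -> 0 < (u + t *: (v - u)) 0 i.
Proof.
move=> /andP[t0 t1] u0 v0; rewrite !mxE.
have [->|t1'] := eqVneq t 1; first by rewrite mul1r addrC subrK.
have {}t1 : t < 1 by rewrite lt_neqAle t1'.
nra.
Qed.

Lemma ball_segment (R : realType) (V : normedModType R) (a u v : V) (r t : R) :
  0 <= t <= 1 -> ball a r u -> ball a r v -> ball a r (u + t *: (v - u)).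
Proof.
move=> /andP[t0 t1]; rewrite -ball_normE /= => au av.
have -> : a - (u + t *: (v - u)) = (1 - t) *: (a - u) + t *: (a - v).
  rewrite scalerBl scale1r -addrA [- (t *: (a - u)) + _]addrC -scalerBr.
  by rewrite opprB [a - v + _]addrC subrKA opprD addrA -scalerN opprB.
have := ler_normD ((1 - t) *: (a - u)) (t *: (a - v)).
rewrite !normrZ [`|t|]ger0_norm// ger0_norm ?subr_ge0// => h.
apply: le_lt_trans h _; pose m := Num.max `|a - u| `|a - v|.
have mr : m < r by rewrite gt_max au av.
apply: le_lt_trans mr; have -> : m = (1 - t) * m + t * m by ring.
by rewrite lerD// ler_wpM2l ?subr_ge0// le_max lexx ?orbT.
Qed.

(* The image by [phi] of the segment [[u, v]] is connected and avoids the
   boundary of [D], because [psi] sends the boundary to [x_d = 0]. *)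
Lemma boundary_flatten (R : realType) (d : nat) (D B : set 'rV[R]_d.+1)
    (psi phi : 'rV[R]_d.+1 -> 'rV[R]_d.+1) (q : 'rV[R]_d.+1) (rho L : R) :
  open D ->
  (forall x, B x -> phi (psi x) = x) ->
  psi @` (B `&` boundary D) `<=` [set x | x 0 ord_max = 0] ->
  ball q rho `<=` psi @` B ->
  (forall x y, ball q rho x -> ball q rho y ->
    `|phi x - phi y| <= L * `|x - y|) ->
  forall u v, ball q rho u -> ball q rho v ->
    0 < u 0 ord_max -> 0 < v 0 ord_max -> D (phi u) -> D (phi v).
Proof.
move=> oD phiK bd0 qB phiL u v qu qv u0 v0 Du.
pose g (t : R) := u + t *: (v - u).
have qg t : 0 <= t <= 1 -> ball q rho (g t) by move=> t01; exact: ball_segment.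
have g0 t : 0 <= t <= 1 -> 0 < g t 0 ord_max.
  by move=> t01; exact: segment_coord_gt0.
have gc : {within `[0, 1], continuous (phi \o g)}.
  apply: (@within_lip_continuous _ _ _ _ _ (L * `|v - u|)) => s t /=.
  rewrite !in_itv /= => s01 t01; apply: le_trans (phiL _ _ (qg s s01) (qg t t01)) _.
  rewrite -mulrA le_eqVlt; apply/orP; left; apply/eqP; congr (_ * _).
  by rewrite /g opprD addrACA subrr add0r -scalerBl normrZ mulrC.
have /= conn := connected_continuous_connected (@segment_connected R 0 1) gc.
have img0 : ((phi \o g) @` `[0, 1]) (phi u).
  exists 0 => /=; first by rewrite in_itv /= lexx ler01.
  by rewrite /g scale0r addr0.
have img1 : ((phi \o g) @` `[0, 1]) (phi v).
  exists 1 => /=; first by rewrite in_itv /= lexx ler01.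
  by rewrite /g scale1r addrC subrK.
suff E : (phi \o g) @` `[0, 1] `&` D = (phi \o g) @` `[0, 1].
  by move: img1; rewrite -E => -[].
apply: conn.
- by exists (phi u).
- by exists D.
- exists (closure D); first exact: closed_closure.
  apply/seteqP; split=> [p [? Dp]|p [[t t01 <-] /= Dp]].
    by split=> //; exact: subset_closure.
  split; first by exists t.
  (* In [closure D] but not in the open set [D], the point would lie on the boundary, and [g t]
     would have last coordinate 0. *)
  apply: contrapT => nDp.
  move: t01; rewrite /= in_itv /= => t01.
  have [x Bx gx] := qB _ (qg t t01).
  have /bd0 : (psi @` (B `&` boundary D)) (g t).
    exists x => //; split=> //; rewrite -(phiK x Bx) gx; split=> //.
    by move/interior_id: oD => ->.
  by move=> /= gt0; have := g0 t t01; rewrite gt0 ltxx.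
Qed.

Lemma closure_half_ball (R : realType) (V : normedModType R) (a : V) (r : R) :
  0 < r -> closure (ball a (r / 2)) `<=` ball a r.
Proof.
move=> r0; rewrite -/(closed_ball a (r / 2)) closed_ballE ?divr_gt0//.
rewrite -ball_normE => x /= ax; apply: le_lt_trans ax _.
by rewrite ltr_pdivrMr// ltr_pMr// ltr1n.
Qed.

Lemma ball_sub_eball (R : realType) (d : nat) (x : 'rV[R]_d.+1) (r : R) :
  0 < r -> ball x (r / d.+1%:R) `<=` eball x r.
Proof.
move=> r0 y; rewrite -ball_normE /eball /= distrC => xy.
apply: le_lt_trans (enorm_le_normr _) _.
by rewrite mulrC -ltr_pdivlMr// ltr0n.
Qed.

(** * The Lipschitz estimate on the domain, first local and then global *)

(** Near a boundary point the straight segment between [x] and [y] may leave [D]; the preimage of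
    the segment between their chart images does not. *)
Lemma lip_near_closure (R : realType) (d : nat) (alpha M : R)
    (D : set 'rV[R]_d.+1) (f : 'rV[R]_d.+1 -> R) :
  open D -> holder_boundary 2 alpha D -> 0 <= M -> bounded_partials D f M ->
  forall x0, closure D x0 -> exists r C : R, [/\ 0 < r, 0 <= C &
    forall x y, ball x0 r x -> ball x0 r y -> D x -> D y ->
      `|f x - f y| <= C * `|x - y|].
Proof.
move=> oD bD M0 fM.
pose C1 := d.+1%:R * M; have C10 : 0 <= C1 by rewrite mulr_ge0.
have lip_in x : D x -> exists2 r : R, 0 < r & ball x r `<=` D /\
    forall y z, ball x r y -> ball x r z -> `|f y - f z| <= C1 * `|y - z|.
  move=> Dx; have /nbhs_ballP[r /= r0 rD] : nbhs x D by exact: open_nbhs_nbhs.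
  exists r => //; split=> // y z xy xz.
  by apply: (@lip_cube _ _ f x r M) => // i w /rD /fM h; case: (h i).
move=> x0 cDx0; have [Dx0|nDx0] := pselect (D x0).
  have [r r0 [rD rf]] := lip_in x0 Dx0.
  by exists r, C1; split=> // x y rx ry _ _; exact: rf.
have bDx0 : boundary D x0 by split=> //; move/interior_id: (oD) => ->.
have [r [psi [phi [r0 [phiK oA] psi_pos psi_bd [psiH phiH]]]]] := bD _ bDx0.
set B := eball x0 r in phiK oA psi_pos psi_bd psiH phiH.
set A := psi @` B in oA phiH.
have Bx0 : B x0 by apply: (ball_sub_eball r0); apply: ballxx; rewrite divr_gt0.
(* Dividing by [d.+1] fits a cube into the Euclidean ball, and halving makes room for its
   closure. *)
pose r1 := r / d.+1%:R / 2; have r10 : 0 < r1 by rewrite !divr_gt0.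
have clB : closure (ball x0 r1) `<=` B.
  apply: subset_trans (ball_sub_eball r0).
  by apply: closure_half_ball; rewrite divr_gt0.
have [L0 L00 psiL] := holder_map_lip clB psiH.
have Aq : A (psi x0) by exists x0.
have /nbhs_ballP[rho0 /= rho00 rhoA] : nbhs (psi x0) A by exact: open_nbhs_nbhs.
pose rho := rho0 / 2; have rho_gt0 : 0 < rho by rewrite divr_gt0.
have clA : closure (ball (psi x0) rho) `<=` A.
  exact: subset_trans (closure_half_ball _) rhoA.
have [L1 L10 phiL] := holder_map_lip clA phiH.
have QA : ball (psi x0) rho `<=` A := subset_trans (@subset_closure _ _) clA.
(* Small enough for [psi] to send the cube of radius [r2] into the cube of radius [rho], where [phi]
   is Lipschitz; adding 1 avoids division by 0. *)
pose r2 := Num.min r1 (rho / (L0 + 1)).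
have L01 : 0 < L0 + 1 by rewrite ltr_wpDl.
have r20 : 0 < r2 by rewrite lt_min r10 divr_gt0.
have sub21 : ball x0 r2 `<=` ball x0 r1.
  by apply: le_ball; rewrite ge_min lexx.
have sub2B : ball x0 r2 `<=` B.
  exact: subset_trans sub21 (subset_trans (@subset_closure _ _) clB).
have psiQ x : ball x0 r2 x -> ball (psi x0) rho (psi x).
  move=> r2x; have := psiL x0 x (ballxx _ r10) (sub21 _ r2x).
  move: r2x; rewrite -!ball_normE /= lt_min => /andP[_].
  rewrite ltr_pdivlMr// => h1 h2; apply: le_lt_trans h2 _.
  by apply: le_lt_trans h1; rewrite mulrC ler_wpM2l// lerDl.
have psi_gt0 x : ball x0 r2 x -> D x -> 0 < psi x 0 ord_max.
  by move=> r2x Dx; apply: psi_pos; exists x => //; split=> //; exact: sub2B.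
(* The chart hypotheses send [D] into the upper half space, but not conversely. One point [w] of [D]
   near [x0] gives the converse: [boundary_flatten] carries membership in [D] from [phi (psi w) = w]
   to the whole upper half of the cube. *)
have [w Dw r2w] := closure_near r20 cDx0.
have {}r2w : ball x0 r2 w by rewrite -ball_normE.
have phiD u : ball (psi x0) rho u -> 0 < u 0 ord_max -> D (phi u).
  move=> Qu u0; apply: (boundary_flatten oD phiK psi_bd QA phiL (psiQ _ r2w)) => //.
    exact: psi_gt0.
  by rewrite phiK//; exact: sub2B.
(* The product of the Lipschitz constants of [f] on small cubes, of [phi] and of [psi]. *)
exists r2, (C1 * L1 * L0); split=> //; first by rewrite !mulr_ge0.
move=> x y r2x r2y Dx Dy.
apply: (@le_trans _ _ (C1 * L1 * `|psi x - psi y|)); last first.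
  by rewrite -[leRHS]mulrA ler_wpM2l ?mulr_ge0// psiL//; exact: sub21.
rewrite -{1}(phiK x (sub2B _ r2x)) -{1}(phiK y (sub2B _ r2y)).
set u := psi x; set v := psi y.
have [Qu Qv] : ball (psi x0) rho u /\ ball (psi x0) rho v by split; exact: psiQ.
have [u0 v0] : 0 < u 0 ord_max /\ 0 < v 0 ord_max by split; exact: psi_gt0.
pose g (t : R) := v + t *: (u - v).
have qg t : 0 <= t <= 1 -> ball (psi x0) rho (g t).
  by move=> t01; exact: ball_segment.
have g0 t : 0 <= t <= 1 -> 0 < g t 0 ord_max.
  by move=> t01; exact: segment_coord_gt0.
(* No chain rule is needed: [f] and [phi] are locally Lipschitz with uniform
   constants, hence so is their composition along the segment. *)
have := @lip_segment _ (f \o phi \o g) (C1 * L1 * `|u - v|).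
rewrite /= /g scale1r scale0r addr0 [v + _]addrC subrK; apply.
  by rewrite !mulr_ge0.
move=> t t01; rewrite -/(g t).
have [e e0 [_ fe]] := lip_in _ (phiD _ (qg t t01) (g0 t t01)).
have K0 : 0 < L1 * `|u - v| + 1 by rewrite ltr_wpDl// mulr_ge0.
have gL s : 0 <= s <= 1 ->
    `|phi (g s) - phi (g t)| <= L1 * `|u - v| * `|s - t|.
  move=> s01; apply: le_trans (phiL _ _ (qg s s01) (qg t t01)) _.
  rewrite -mulrA ler_wpM2l// /g opprD addrACA subrr add0r -scalerBl normrZ.
  by rewrite mulrC.
near=> s => s01; rewrite -/(g s).
apply: le_trans (fe _ _ _ (ballxx _ e0)) _; last first.
  have -> : C1 * L1 * `|u - v| * `|s - t| = C1 * (L1 * `|u - v| * `|s - t|).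
    by rewrite !mulrA.
  by apply: ler_wpM2l => //; exact: gL.
rewrite -ball_normE /= distrC; apply: le_lt_trans (gL s s01) _.
apply: (@le_lt_trans _ _ ((L1 * `|u - v| + 1) * `|s - t|)).
  by rewrite ler_wpM2r// lerDl.
rewrite mulrC -ltr_pdivlMr// distrC; near: s.
by apply: cvgr_dist_lt; [exact: cvg_id|rewrite divr_gt0].
Unshelve. all: by end_near. Qed.

Lemma lip_domain (R : realType) (d : nat) (alpha M : R)
    (D : set 'rV[R]_d.+1) (f : 'rV[R]_d.+1 -> R) :
  open D -> bounded_set D -> holder_boundary 2 alpha D ->
  0 <= M -> bounded_partials D f M ->
  exists2 C, 0 <= C &
    forall x y, D x -> D y -> `|f x - f y| <= C * `|x - y|.
Proof.
move=> oD bD hD M0 fM.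
have loc := lip_near_closure oD hD M0 fM.
(* The local Lipschitz estimate bounds [f] near [x0] by comparison with one point [w] of [D]. *)
have bnd x0 : closure D x0 -> exists r m : R, [/\ 0 < r, 0 <= m &
    forall x, ball x0 r x -> D x -> `|f x| <= m].
  move=> cx0; have [r [C [r0 C0 fC]]] := loc _ cx0.
  have [w Dw rw] := closure_near r0 cx0.
  exists r, (`|f w| + C * (r + r)); split=> //.
    by rewrite addr_ge0// mulr_ge0// addr_ge0// ltW.
  move=> x rx Dx; rewrite -(subrK (f w) (f x)) addrC.
  apply: le_trans (ler_normD _ _) _; rewrite lerD2l.
  apply: le_trans (fC x w rx _ Dx Dw) _; first by rewrite -ball_normE.
  rewrite ler_wpM2l//; move: rx; rewrite -ball_normE /= => rx.
  have -> : x - w = (x0 - w) - (x0 - x) by rewrite opprB [x0 - w + _]addrC subrKA.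
  by apply: le_trans (ler_normB _ _) _; rewrite lerD ?ltW.
(* Uniformize the constant by compactness of the set of pairs; off the diagonal
   [`|x - y|] is bounded below and [f] is locally bounded. *)
have cK := compact_closure_bounded bD.
have /compact_near_coveringP cov := compact_setX cK cK.
pose P (C : R) (p : 'rV[R]_d.+1 * 'rV[R]_d.+1) :=
  D p.1 -> D p.2 -> `|f p.1 - f p.2| <= C * `|p.1 - p.2|.
(* Asking for all large [C] lets finitely many local constants be combined. *)
have : \forall C \near +oo, closure D `*` closure D `<=` P C.
  apply: cov => -[x0 y0] [/= cx0 cy0].
  have [<-|xy0] := eqVneq x0 y0.
    have [r [C [r0 C0 fC]]] := loc _ cx0.
    exists ([set p | ball x0 r p.1 /\ ball x0 r p.2], [set E | C <= E]).
      split=> /=; last by apply: nbhs_pinfty_ge; exact: num_real.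
      exists (ball x0 r, ball x0 r); first by split; exact: nbhsx_ballx.
      by case=> x y [].
    move=> [[x y] E] [/= [rx ry] CE] Dx Dy /=.
    by apply: le_trans (fC x y rx ry Dx Dy) _; rewrite ler_wpM2r.
  have [r1 [m1 [r10 m10 f1]]] := bnd _ cx0.
  have [r2 [m2 [r20 m20 f2]]] := bnd _ cy0.
  (* A third of the distance: points within [e] of [x0] and [y0] remain at least [e] apart, so
     [(m1 + m2) / e] serves as constant. *)
  pose e := `|x0 - y0| / 3.
  have e0 : 0 < e by rewrite divr_gt0// normr_gt0 subr_eq0.
  exists ([set p | (ball x0 r1 `&` ball x0 e) p.1 /\
                   (ball y0 r2 `&` ball y0 e) p.2],
          [set E | (m1 + m2) / e <= E]).
    split=> /=; last by apply: nbhs_pinfty_ge; exact: num_real.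
    exists (ball x0 r1 `&` ball x0 e, ball y0 r2 `&` ball y0 e) => /=.
      by split; apply: filterI; exact: nbhsx_ballx.
    by case=> x y [].
  move=> [[x y] E] [/= [[rx ex] [ry ey]] mE] Dx Dy /=.
  have E0 : 0 <= E by apply: le_trans mE; rewrite divr_ge0 ?addr_ge0// ltW.
  apply: (@le_trans _ _ (m1 + m2)).
    by apply: le_trans (ler_normB _ _) _; rewrite lerD ?f1 ?f2.
  have exy : e <= `|x - y|.
    move: ex ey; rewrite -!ball_normE /= => ex ey.
    have : x0 - y0 = (x0 - x) + (x - y) - (y0 - y) by rewrite opprB !subrKA.
    move=> Exy; have := ler_normD (x0 - x) (x - y).
    have := ler_normB ((x0 - x) + (x - y)) (y0 - y); rewrite -Exy.
    have : `|x0 - y0| = 3 * e by rewrite /e mulrC divfK.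
    by lra.
  move: mE; rewrite ler_pdivrMr// => mE; apply: le_trans mE _.
  by rewrite ler_wpM2l.
move=> [C0 [_ hC]]; exists (`|C0| + 1) => [|x y Dx Dy]; first by rewrite addr_ge0.
apply: (hC (`|C0| + 1) _ (x, y)) => //.
  by apply: le_lt_trans (ler_norm C0) _; rewrite ltrDl.
by split; exact: subset_closure.
Qed.

(** * Calculus of partial derivatives, and Lipschitz extension *)

(** A derivative of [f] in the single direction [v] suffices: along the line through [x] this is the
    one-variable chain rule. *)
Lemma is_derive_comp (R : realType) (n : nat) (g : R -> R)
    (f : 'rV[R]_n -> R) (x v : 'rV[R]_n) (dg df : R) :
  is_derive (f x) 1 g dg -> is_derive x v f df ->
  is_derive x v (fun y => g (f y)) (dg * df).
Proof.
have x0 : x = x + 0 *: v by rewrite scale0r addr0.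
rewrite x0 => hg /is_derive_lineP hf; apply/is_derive_lineP.
exact: (@is_derive1_comp _ g (fun h => f (x + h *: v)) 0).
Qed.

Lemma partialM (R : realType) (n : nat) (i : 'I_n) (f g : 'rV[R]_n -> R) x :
  partial_exists i f x -> partial_exists i g x ->
  partial_exists i (fun y => f y * g y) x /\
  partial i (fun y => f y * g y) x = f x * partial i g x + g x * partial i f x.
Proof.
by move=> df dg; split; [exact: derivableM df dg|exact: deriveM df dg].
Qed.

Lemma partialZ (R : realType) (n : nat) (i : 'I_n) (c : R)
    (f : 'rV[R]_n -> R) x : partial_exists i f x ->
  partial_exists i (fun y => c * f y) x /\
  partial i (fun y => c * f y) x = c * partial i f x.
Proof. by move=> df; split; [exact: derivableZ df|exact: deriveZ df]. Qed.

Lemma partial_eq_on (R : realType) (n : nat) (D : set 'rV[R]_n) (i : 'I_n)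
    (f g : 'rV[R]_n -> R) x : open D -> D x -> {in D, f =1 g} ->
  (partial_exists i f x -> partial_exists i g x) /\
  partial i f x = partial i g x.
Proof.
move=> oD Dx fg.
have nfg : \near x, f x = g x.
  have : nbhs x D by exact: open_nbhs_nbhs.
  by apply: filterS => y Dy; apply: fg; rewrite inE.
by split; [exact: near_eq_derivable|exact: near_eq_derive].
Qed.

(* McShane's formula. *)
Lemma lip_extension (R : realType) (V : normedModType R) (A : set V)
    (f : V -> R) (C : R) : 0 <= C ->
  (forall x y, A x -> A y -> `|f x - f y| <= C * `|x - y|) ->
  exists2 F : V -> R, {in A, F =1 f} &
    forall x y, `|F x - F y| <= C * `|x - y|.
Proof.
move=> C0 fC; have [[a Aa]|A0] := pselect (A !=set0); last first.
  exists (fun=> 0) => [x|x y]; last by rewrite subrr normr0 mulr_ge0.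
  by rewrite inE => Ax; exfalso; apply: A0; exists x.
pose S x := [set f y + C * `|x - y| | y in A].
have S0 x : S x !=set0 by exists (f a + C * `|x - a|), a.
have tri (x y z : V) : C * `|x - z| <= C * `|x - y| + C * `|y - z|.
  by rewrite -mulrDr ler_wpM2l// -(subrKA y) ler_normD.
(* The base point [a] keeps these values bounded below, so the infimum is finite. *)
have lbS x : has_lbound (S x).
  exists (f a - C * `|x - a|) => _ [y Ay <-].
  have := fC _ _ Aa Ay; have := tri a x y; rewrite (distrC a x).
  by have := ler_norm (f a - f y); lra.
exists (fun x => inf (S x)) => [x|x y].
  rewrite inE => Ax; apply/le_anti/andP; split.
    by apply: ge_inf => //; exists x => //; rewrite subrr normr0 mulr0 addr0.
  apply: lb_le_inf => // _ [y Ay <-].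
  by have := fC _ _ Ax Ay; have := ler_norm (f x - f y); lra.
have half u v : inf (S u) <= inf (S v) + C * `|u - v|.
  rewrite -lerBlDr; apply: lb_le_inf => // _ [z Az <-]; rewrite lerBlDr.
  apply: (@le_trans _ _ (f z + C * `|u - z|)); last by have := tri u v z; lra.
  by apply: ge_inf => //; exists z.
rewrite ler_norml; have := half x y; have := half y x; rewrite (distrC y x).
by move=> h1 h2; apply/andP; split; lra.
Qed.

(** * Regularity up to the boundary *)

(** Continuity on the closure supplies the sup bound and carries the Lipschitz estimate of
    [lip_domain] from [D] to the closure. *)
Lemma bounded_holder_domain (R : realType) (d : nat) (alpha M : R)
    (D : set 'rV[R]_d.+1) (f : 'rV[R]_d.+1 -> R) :
  0 < alpha -> alpha <= 1 ->
  open D -> bounded_set D -> holder_boundary 2 alpha D ->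
  {within closure D, continuous f} -> 0 <= M -> bounded_partials D f M ->
  bounded_holder alpha (closure D) f.
Proof.
move=> a0 a1 oD bD hD fc M0 fM.
have [C C0 fC] := lip_domain oD bD hD M0 fM.
have [N N0 fN] := within_continuous_bounded bD fc.
exact: bounded_lip_holder a0 a1 N0 C0 fN (lip_closure C0 fc fC).
Qed.

Lemma within_continuousM (R : realType) (T : topologicalType) (A : set T)
    (f g : T -> R) :
  {within A, continuous f} -> {within A, continuous g} ->
  {within A, continuous (fun x => f x * g x)}.
Proof.
move=> /subspace_continuousP fc /subspace_continuousP gc.
apply/subspace_continuousP => x Ax.
by apply: cvgM; [exact: fc|exact: gc].
Qed.

(** The derivatives of [s] up to order two are polynomials in [s], the [db i] and their derivatives.
    The first two are Hölder because their partial derivatives are bounded, the last by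
    hypothesis. *)
Lemma exp_half_holder (R : realType) (d : nat) (alpha : R)
    (D : set 'rV[R]_d.+1) (B : 'rV[R]_d.+1 -> R)
    (db : 'I_d.+1 -> 'rV[R]_d.+1 -> R) :
  0 < alpha -> alpha <= 1 ->
  open D -> bounded_set D -> holder_boundary 2 alpha D ->
  {within closure D, continuous B} ->
  (forall i x, D x -> is_derive x (delta_mx 0 i) B (db i x)) ->
  (forall i, holder_closure 1 alpha D (db i)) ->
  let s x := expR (2^-1 * B x) in
  holder_closure 2 alpha D s /\
  forall i x, D x ->
    partial_exists i s x /\ partial i s x = s x * (2^-1 * db i x).
Proof.
move=> a0 a1 oD bD hD Bc dB dbH s.
have sd i x : D x ->
    partial_exists i s x /\ partial i s x = s x * (2^-1 * db i x).
  move=> Dx; pose g (t : R) := expR (2^-1 * t).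
  have dg : is_derive (B x) 1 g (s x * 2^-1).
    rewrite /g /s; apply: (@is_derive1_comp _ expR (fun t => 2^-1 * t)).
    apply: is_derive_eq; by rewrite [_ *: 1]mulr1.
  have [? ?] := is_derive_comp dg (dB i x Dx).
  by rewrite mulrA.
have sc : {within closure D, continuous s}.
  apply: (@within_continuous_comp _ _ _ _ B (fun t => expR (2^-1 * t))) => // t _.
  apply: continuous_comp; first exact: mulrl_continuous.
  exact: continuous_expR.
have dbc i : {within closure D, continuous (db i)} by case: (dbH i).
have dbh i : bounded_holder alpha (closure D) (db i).
  have [M M0 dM] := holder_closure1_partials a0 bD (dbH i).
  exact: bounded_holder_domain (dbc i) M0 dM.
have dsc i : {within closure D, continuous (fun x => s x * (2^-1 * db i x))}.
  apply: within_continuousM => //; apply: within_continuousM => //.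
  by apply/subspace_continuousP => x _; exact: cvg_cst.
(* By their formula the first partial derivatives of [s] extend continuously to the compact closure,
   hence are bounded. *)
have [M M0 sM] : exists2 M, 0 <= M & bounded_partials D s M.
  apply: (bounded_partials_of (P := fun g => {within closure D, continuous g})).
    by move=> g; exact: within_continuous_bounded.
  by move=> i; exists (fun x => s x * (2^-1 * db i x)); split=> // x; exact: sd.
have sh := bounded_holder_domain a0 a1 oD bD hD sc M0 sM.
split=> //; split=> // i; exists (fun x => s x * (2^-1 * db i x)); split; first exact: sd.
split=> // j; have [_ /(_ j)[g [dg gh]]] := dbH i.
have {}gh := uniformly_holder_bounded a0 (bounded_set_closure bD) gh.
(* The product rule for [s * (db i / 2)], with [g] extending the [j]-th derivative of [db i]. *)
exists (fun x => s x * (2^-1 * g x) + (2^-1 * db i x) * (s x * (2^-1 * db j x))).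
split; last first.
  apply: bounded_holder_uniformly.
  have half f : bounded_holder alpha (closure D) f ->
      bounded_holder alpha (closure D) (fun x => 2^-1 * f x).
    exact: bounded_holderM (bounded_holder_cst _ _ _).
  apply: bounded_holderD; first exact: bounded_holderM sh (half _ gh).
  exact: bounded_holderM (half _ (dbh i)) (bounded_holderM sh (half _ (dbh j))).
move=> x Dx; have [sx dsx] := sd j x Dx; have [dbx ddbx] := dg x Dx.
have [hx dhx] := partialZ (2^-1 : R) dbx.
have [px ->] := partialM sx hx.
by split=> //; rewrite dhx dsx ddbx.
Qed.

(** * The risk identity and the choice of the prior *)

(** The identity holds term by term: [V i j * partial j s] is [s / 2] times [V i j * db j], and
    differentiating the factor [s] yields the quadratic term of the risk. *)
Lemma risk_exp (R : realType) (n : nat) (D : set 'rV[R]_n)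
    (V : 'rV[R]_n -> 'M[R]_n) (s : 'rV[R]_n -> R)
    (db : 'I_n -> 'rV[R]_n -> R) (x : 'rV[R]_n) :
  open D -> D x -> s x != 0 ->
  (forall i j, partial_exists i (fun y => V y i j) x) ->
  (forall i j, partial_exists i (db j) x) ->
  (forall i y, D y ->
     partial_exists i s y /\ partial i s y = s y * (2^-1 * db i y)) ->
  risk V db x =
    2 * (\sum_i \sum_j partial i (fun y => V y i j * partial j s y) x) / s x.
Proof.
move=> oD Dx s0 dV ddb sd.
suff -> : \sum_i \sum_j partial i (fun y => V y i j * partial j s y) x =
    s x * 2^-1 * risk V db x by field.
rewrite mulr_sumr; apply: eq_bigr => i _; rewrite mulr_sumr.
apply: eq_bigr => j _.
(* The formula for [partial j s] holds on the open set [D], so it may be used under [partial i]. *)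
have -> : partial i (fun y => V y i j * partial j s y) x =
    partial i (fun y => s y * (2^-1 * (V y i j * db j y))) x.
  apply: (partial_eq_on i oD Dx _).2 => y; rewrite inE => Dy.
  by have [_ ->] := sd j y Dy; ring.
have [sx dsx] := sd i x Dx.
have [vx dvx] := partialM (dV i j) (ddb i j).
have [hx dhx] := partialZ (2^-1 : R) vx.
have [_ ->] := partialM sx hx.
by rewrite dhx dsx; field.
Qed.

Theorem theorem1 (R : realType) (d : nat) (alpha : R)
  (D : set 'rV[R]_d.+1)
  (V : 'rV[R]_d.+1 -> 'M[R]_d.+1)
  (b : 'rV[R]_d.+1 -> R)
  (db : 'I_d.+1 -> 'rV[R]_d.+1 -> R)
  (alpha_gt0 : 0 < alpha) (alpha_le1 : alpha <= 1)
  (D_domain : is_domain D) (D_bounded : bounded_set D)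
  (D_boundary : holder_boundary 2 alpha D)
  (V_sym : forall x, closure D x -> (V x)^T = V x)
  (V_holder : forall i j, holder_closure 1 alpha D (fun x => V x i j))
  (V_posdef : forall x, closure D x -> positive_definite (V x))
  (b_gradient : forall i x, D x ->
     partial_exists i b x /\ partial i b x = db i x)
  (db_holder : forall i, holder_closure 1 alpha D (db i)) :
  exists p : 'rV[R]_d.+1 -> R,
    [/\ holder_closure 2 alpha D (fun x => Num.sqrt (p x)),
        (forall x, D x -> 0 < p x) &
        forall x, D x ->
          risk V db x = risk V (prior_decision p) x /\
          risk V (prior_decision p) x =
            2 * (\sum_i \sum_j
                   partial i
                     (fun y => V y i j * partial j (fun z => Num.sqrt (p z)) y)
                     x)
              / Num.sqrt (p x)].
Proof.
have [oD _] := D_domain.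
have [M M0 bM] : exists2 M, 0 <= M & bounded_partials D b M.
  apply: (bounded_partials_of (P := holder_closure 1 alpha D)).
    by move=> g [gc _]; exact: within_continuous_bounded gc.
  by move=> i; exists (db i); split=> // x; exact: b_gradient.
have [C C0 bC] := lip_domain oD D_bounded D_boundary M0 bM.
(* The values of [b] outside [D] are arbitrary, so [b] is replaced by a Lipschitz function agreeing
   with it on [D]. *)
have [B bB BC] := lip_extension C0 bC.
have Bc : {within closure D, continuous B}.
  by apply: (@within_lip_continuous _ _ _ _ _ C) => x y _ _; exact: BC.
have dB i x : D x -> is_derive x (delta_mx 0 i) B (db i x).
  move=> Dx; have [bx dbx] := b_gradient i x Dx.
  have [Bx e] := partial_eq_on i oD Dx (fun y Dy => esym (bB y Dy)).
  by split; [exact: Bx|rewrite -dbx e].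
pose s x := expR (2^-1 * B x).
have [sH sd] := exp_half_holder alpha_gt0 alpha_le1 oD D_bounded D_boundary
  Bc dB db_holder.
have sqrt_p : (fun x => Num.sqrt (expR (B x))) = s.
  apply/funext => x; have -> : B x = 2^-1 * B x + 2^-1 * B x by field.
  by rewrite expRD -expr2 sqrtr_sqr ger0_norm ?expR_ge0.
have pd i y : D y -> prior_decision (fun x => expR (B x)) i y = db i y.
  move=> Dy; rewrite /prior_decision.
  have -> : (fun x => ln (expR (B x))) = B by apply/funext => x; rewrite expRK.
  by have [_] := dB i y Dy.
exists (fun x => expR (B x)); rewrite sqrt_p; split=> // [x _|x Dx].
  exact: expR_gt0.
(* The two decision functions are known to agree on [D], which is open, so one may replace the other
   under [partial i]. *)
have risk_p : risk V (prior_decision (fun x => expR (B x))) x = risk V db x.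
  apply: eq_bigr => i _; apply: eq_bigr => j _; rewrite !pd//; congr (_ + _).
  by apply: (partial_eq_on i oD Dx _).2 => y; rewrite inE => Dy; rewrite pd.
rewrite risk_p; split=> //.
have /= -> := congr1 (fun f => f x) sqrt_p.
apply: (risk_exp oD Dx) => // [|i j|i j].
- by rewrite gt_eqF ?expR_gt0.
- by have [_ /(_ i)[g [/(_ x Dx)[]]]] := V_holder i j.
- by have [_ /(_ i)[g [/(_ x Dx)[]]]] := db_holder j.
Qed.
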